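(* Let $H$ be a Hilbert module over a $C^*$-algebra. Suppose that $P\in \mathcal{L}(H)$ is a projection and $Q\in\mathcal{L}(H)$ is an idempotent. Then the following statements are equivalent: (i) $(P,Q)$ is a quasi-projection pair; (ii) $Q^*=(2P-I)Q(2P-I)$; (iii) $|Q^*|=(2P-I)|Q|(2P-I)$.
   Context: $\mathcal{L}(H)$ is the $C^*$-algebra of adjointable operators on the Hilbert $C^*$-module $H$, and $I$ is the identity operator on $H$. An idempotent is $Q\in\mathcal{L}(H)$ with $Q^2=Q$; a projection is an idempotent $P$ with $P^*=P$. $|T|=(T^*T)^{1/2}$, so $|Q|=(Q^*Q)^{1/2}$ and $|Q^*|=(QQ^* )^{1/2}$. An ordered pair $(P,Q)$, with $P\in\mathcal{L}(H)$ a projection and $Q\in\mathcal{L}(H)$ an idempotent, is called a quasi-projection pair if $PQ^*P=PQP$, $PQ^*(I-P)=-PQ(I-P)$, and $(I-P)Q^*(I-P)=(I-P)Q(I-P)$. *)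

(* Defs.v *)
From HB Require Import structures.
From mathcomp Require Import all_boot all_order all_algebra.
From mathcomp Require Import boolp classical_sets reals topology normedtype.
From mathcomp Require Import complex.
Set Implicit Arguments.
Unset Strict Implicit.
Unset Printing Implicit Defensive.
Import Order.TTheory GRing.Theory Num.Theory.
Import numFieldNormedType.Exports.

Local Open Scope ring_scope.
Local Open Scope complex_scope.

(* Associative complex *-algebras, not assumed unital: the ring structures of
   the library all have a unit, whence the separate product smul. *)
HB.mixin Record isStarAlgebra (R : realType) A of GRing.Lmodule R[i] A := {
  smul : A -> A -> A;
  star : A -> A;
  smulA : associative smul;
  smulDl : left_distributive smul +%R;
  smulDr : right_distributive smul +%R;
  smulZl : forall (l : R[i]) (a b : A), smul (l *: a) b = l *: smul a b;
  smulZr : forall (l : R[i]) (a b : A), smul a (l *: b) = l *: smul a b;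
  starK : involutive star;
  starD : {morph star : a b / a + b};
  starZ : forall (l : R[i]) (a : A), star (l *: a) = Num.conj l *: star a;
  starM : forall a b : A, star (smul a b) = smul (star b) (star a);
}.

#[short(type="starAlgType")]
HB.structure Definition StarAlgebra (R : realType) :=
  {A of isStarAlgebra R A & GRing.Lmodule R[i] A}.

Declare Scope star_scope.
Delimit Scope star_scope with star.
Notation "a ** b" := (smul a b) (at level 40, left associativity) : star_scope.
Local Open Scope star_scope.

HB.mixin Record isCStarAlgebra (R : realType) A
    of StarAlgebra R A & CompleteNormedModule R[i] A := {
  cstar_normM : forall a b : A, `|a ** b| <= `|a| * `|b|;
  cstar_norm : forall a : A, `|star a ** a| = `|a| ^+ 2;
}.

#[short(type="cstarAlgType")]
HB.structure Definition CStarAlgebra (R : realType) :=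
  {A of isCStarAlgebra R A & StarAlgebra R A & CompleteNormedModule R[i] A}.

Section Positivity.
Variables (R : realType) (A : starAlgType R).
Implicit Types (a b : A) (l : R[i]) (u v : A * R[i]).

(* The pair (a, l) stands for the element a + l 1 of the unitization of A. *)
Definition unitization_mul u v : A * R[i] :=
  (u.1 ** v.1 + u.2 *: v.1 + v.2 *: u.1, u.2 * v.2).
Definition unitization_one : A * R[i] := (0, 1).
Definition unitization_invertible u : Prop :=
  exists v, unitization_mul u v = unitization_one /\
            unitization_mul v u = unitization_one.

(* When A already has a unit, this set differs from the spectrum relative to A
   at most by the point 0, which is irrelevant to positivity. *)
Definition spectrum a : set R[i] :=
  [set l | ~ unitization_invertible (- a, l)].

(* In R[i], [0 <= l] means that l is a nonnegative real number. *)
Definition positive a : Prop :=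
  star a = a /\ forall l, spectrum a l -> 0 <= l.

(* The positive square root of a positive element; in a C*-algebra it exists
   and is unique, and 0 is only a default value. *)
Definition psqrt a : A := xget 0 [set b | positive b /\ b ** b = a].

Definition modulus a : A := psqrt (star a ** a).

End Positivity.

(* Right Hilbert modules over A. The inner product is linear in its second
   variable. The norm carried by H is the one given by the inner product, and H
   is complete for it. *)
HB.mixin Record isHilbertModule (R : realType) (A : cstarAlgType R) H
    of CompleteNormedModule R[i] H := {
  hact : H -> A -> H;
  hip : H -> H -> A;
  hactDl : forall (x y : H) (a : A), hact (x + y) a = hact x a + hact y a;
  hactDr : forall (x : H) (a b : A), hact x (a + b) = hact x a + hact x b;
  hactM : forall (x : H) (a b : A), hact x (a ** b) = hact (hact x a) b;
  hactZl : forall (l : R[i]) (x : H) (a : A), hact (l *: x) a = l *: hact x a;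
  hactZr : forall (l : R[i]) (x : H) (a : A), hact x (l *: a) = l *: hact x a;
  hipDr : forall x y z : H, hip x (y + z) = hip x y + hip x z;
  hipZr : forall (l : R[i]) (x y : H), hip x (l *: y) = l *: hip x y;
  hip_act : forall (x y : H) (a : A), hip x (hact y a) = hip x y ** a;
  hip_star : forall x y : H, star (hip x y) = hip y x;
  hip_ge0 : forall x : H, positive (hip x x);
  hip_eq0 : forall x : H, hip x x = 0 -> x = 0;
  hip_norm : forall x : H, `|x| ^+ 2 = `|hip x x|;
}.

#[short(type="hilbertModType")]
HB.structure Definition HilbertModule (R : realType) (A : cstarAlgType R) :=
  {H of isHilbertModule R A H & CompleteNormedModule R[i] H}.

Section HilbertModuleTheory.
Variables (R : realType) (A : cstarAlgType R) (H : hilbertModType A).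
Implicit Types x y z : H.

Lemma hipDl x y z : hip (x + y) z = hip x z + hip y z.
Proof. by rewrite -[LHS]hip_star hipDr starD !hip_star. Qed.

Lemma hipZl (l : R[i]) x y : hip (l *: x) y = Num.conj l *: hip x y.
Proof. by rewrite -[LHS]hip_star hipZr starZ hip_star. Qed.

Lemma hip0r x : hip x 0 = 0.
Proof. by rewrite -(scale0r (0 : H)) hipZr scale0r. Qed.

Lemma hip0l x : hip 0 x = 0.
Proof. by rewrite -(scale0r (0 : H)) hipZl rmorph0 scale0r. Qed.

Lemma hipNr x y : hip x (- y) = - hip x y.
Proof. by rewrite -scaleN1r hipZr scaleN1r. Qed.

Lemma hipNl x y : hip (- x) y = - hip x y.
Proof. by rewrite -scaleN1r hipZl rmorphN1 scaleN1r. Qed.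

Lemma hip_injl x y : (forall z, hip x z = hip y z) -> x = y.
Proof.
move=> h; apply/eqP; rewrite -subr_eq0; apply/eqP/hip_eq0.
by rewrite hipDl hipNl h subrr.
Qed.

Lemma hip_injr x y : (forall z, hip z x = hip z y) -> x = y.
Proof.
by move=> h; apply: hip_injl => z; rewrite -hip_star h hip_star.
Qed.

End HilbertModuleTheory.

(* Linearity and A-linearity of the map, as well as uniqueness of the adjoint,
   follow from the adjunction identity (see adjointableP below). *)
Record adjointable (R : realType) (A : cstarAlgType R) (H : hilbertModType A) :=
  Adjointable {
    adj_fun :> H -> H;
    adj_adj : H -> H;
    adj_funP : forall x y : H, hip (adj_fun x) y = hip x (adj_adj y);
  }.

Section AdjointableAlgebra.
Variables (R : realType) (A : cstarAlgType R) (H : hilbertModType A).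
Local Notation L := (adjointable H).
Implicit Types (S T U : L) (x y : H) (l : R[i]).

Lemma adj_adjP T x y : hip (adj_adj T x) y = hip x (T y).
Proof. by rewrite -[LHS]hip_star -adj_funP hip_star. Qed.

Lemma adjointableP S T : S =1 T -> S = T.
Proof.
case: S T => [f f' fP] [g g' gP] /= fg.
have {}fg : f = g by apply: funext.
move: gP; rewrite -fg => gP.
have e : f' = g'.
  by apply: funext => y; apply: hip_injr => x; rewrite -fP gP.
move: gP; rewrite -e => gP.
by congr Adjointable; apply: Prop_irrelevance.
Qed.

Lemma adjointable_act T x (a : A) : T (hact x a) = hact (T x) a.
Proof.
by apply: hip_injr => z; rewrite -adj_adjP !hip_act adj_adjP.
Qed.

Fact adjointable0_subproof x y : hip (0 : H) y = hip x (0 : H).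
Proof. by rewrite hip0l hip0r. Qed.
Definition adjointable0 : L := Adjointable adjointable0_subproof.

Fact adjointable1_subproof x y : hip x y = hip x y.
Proof. by []. Qed.
Definition adjointable1 : L := Adjointable adjointable1_subproof.

Fact adjointableN_subproof T x y : hip (- T x) y = hip x (- adj_adj T y).
Proof. by rewrite hipNl hipNr adj_funP. Qed.
Definition adjointableN T : L := Adjointable (adjointableN_subproof T).

Fact adjointableD_subproof S T x y :
  hip (S x + T x) y = hip x (adj_adj S y + adj_adj T y).
Proof. by rewrite hipDl hipDr !adj_funP. Qed.
Definition adjointableD S T : L := Adjointable (adjointableD_subproof S T).

Fact adjointableZ_subproof l T x y :
  hip (l *: T x) y = hip x (Num.conj l *: adj_adj T y).
Proof. by rewrite hipZl hipZr adj_funP. Qed.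
Definition adjointableZ l T : L := Adjointable (adjointableZ_subproof l T).

Fact adjointableM_subproof S T x y :
  hip (S (T x)) y = hip x (adj_adj T (adj_adj S y)).
Proof. by rewrite !adj_funP. Qed.
Definition adjointableM S T : L := Adjointable (adjointableM_subproof S T).

Definition adjointable_star T : L := Adjointable (adj_adjP T).

HB.instance Definition _ := gen_eqMixin L.
HB.instance Definition _ := gen_choiceMixin L.

Fact adjointableDA : associative adjointableD.
Proof. by move=> S T U; apply: adjointableP => x /=; rewrite addrA. Qed.
Fact adjointableDC : commutative adjointableD.
Proof. by move=> S T; apply: adjointableP => x /=; rewrite addrC. Qed.
Fact adjointable0D : left_id adjointable0 adjointableD.
Proof. by move=> T; apply: adjointableP => x /=; rewrite add0r. Qed.
Fact adjointableND : left_inverse adjointable0 adjointableN adjointableD.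
Proof. by move=> T; apply: adjointableP => x /=; rewrite addNr. Qed.

HB.instance Definition _ := GRing.isZmodule.Build L
  adjointableDA adjointableDC adjointable0D adjointableND.

Lemma adjointable_additive T x y : T (x + y) = T x + T y.
Proof. by apply: hip_injr => z; rewrite hipDr -!adj_adjP hipDr. Qed.

Lemma adjointable_scalable T l x : T (l *: x) = l *: T x.
Proof. by apply: hip_injr => z; rewrite hipZr -!adj_adjP hipZr. Qed.

Fact adjointableMA : associative adjointableM.
Proof. by move=> S T U; apply: adjointableP. Qed.
Fact adjointable1M : left_id adjointable1 adjointableM.
Proof. by move=> T; apply: adjointableP. Qed.
Fact adjointableM1 : right_id adjointable1 adjointableM.
Proof. by move=> T; apply: adjointableP. Qed.
Fact adjointableMDl : left_distributive adjointableM +%R.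
Proof. by move=> S T U; apply: adjointableP. Qed.
Fact adjointableMDr : right_distributive adjointableM +%R.
Proof.
by move=> S T U; apply: adjointableP => x /=; rewrite adjointable_additive.
Qed.

HB.instance Definition _ := GRing.Zmodule_isPzRing.Build L
  adjointableMA adjointable1M adjointableM1 adjointableMDl adjointableMDr.

Fact adjointableZA l (k : R[i]) T :
  adjointableZ l (adjointableZ k T) = adjointableZ (l * k) T.
Proof. by apply: adjointableP => x /=; rewrite scalerA. Qed.
Fact adjointable1Z : left_id 1 adjointableZ.
Proof. by move=> T; apply: adjointableP => x /=; rewrite scale1r. Qed.
Fact adjointableZDr : right_distributive adjointableZ +%R.
Proof. by move=> l S T; apply: adjointableP => x /=; rewrite scalerDr. Qed.
Fact adjointableZDl T : {morph adjointableZ^~ T : l k / l + k}.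
Proof. by move=> l k; apply: adjointableP => x /=; rewrite scalerDl. Qed.

HB.instance Definition _ := GRing.Zmodule_isLmodule.Build R[i] L
  adjointableZA adjointable1Z adjointableZDr adjointableZDl.

Fact adjointableMZl l S T : (l *: S) * T = l *: (S * T).
Proof. by apply: adjointableP. Qed.
Fact adjointableMZr l S T : S * (l *: T) = l *: (S * T).
Proof. by apply: adjointableP => x /=; rewrite adjointable_scalable. Qed.
Fact adjointable_starK : involutive adjointable_star.
Proof. by move=> T; apply: adjointableP. Qed.
Fact adjointable_starD : {morph adjointable_star : S T / S + T}.
Proof. by move=> S T; apply: adjointableP. Qed.
Fact adjointable_starZ l T :
  adjointable_star (l *: T) = Num.conj l *: adjointable_star T.
Proof. by apply: adjointableP. Qed.
Fact adjointable_starM S T :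
  adjointable_star (S * T) = adjointable_star T * adjointable_star S.
Proof. by apply: adjointableP. Qed.

HB.instance Definition _ := isStarAlgebra.Build R L
  (@mulrA L) (@mulrDl L) (@mulrDr L) adjointableMZl adjointableMZr
  adjointable_starK adjointable_starD adjointable_starZ adjointable_starM.

Lemma adjointable_smulE S T : S ** T = S * T.
Proof. by []. Qed.

Definition is_idempotent T : Prop := T * T = T.
Definition is_projection T : Prop := is_idempotent T /\ star T = T.

Definition quasi_projection_pair P Q : Prop :=
  [/\ is_projection P /\ is_idempotent Q,
      P * star Q * P = P * Q * P,
      P * star Q * (1 - P) = - (P * Q * (1 - P))
    & (1 - P) * star Q * (1 - P) = (1 - P) * Q * (1 - P)].

End AdjointableAlgebra.

Notation "''L' ( H )" := (adjointable H) (format "''L' ( H )") : type_scope.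

(* Main.v *)
(* No order theory of A is needed. The triangle inequality of H bounds inner
   products by polarization, so adjointable operators are bounded and can be
   handled by contractions. A selfadjoint h satisfies
   |(h + it)y| = |(h - it)y|, whence t|y| <= |(h + it)y| and h + it is
   invertible; descending from large t, a selfadjoint a with all a + t (t >= 0)
   invertible has a selfadjoint fourth root in its bicommutant.

   For an idempotent Q put S = QQ* and k = 1 - N^2 with N = Q - Q*. Then k is
   invertible and kS = S^2, so p = S k^-1 is the range projection of Q, and
   S + (1 - p) has a fourth root g. Hence (p g)^2 is a positive square root of S, and it is the
   only one: any other, c, commutes with p and g, and c + (1 - p) and g^2 have
   the same square and an invertible sum.

   With J = 2P - 1, a symmetry, (ii) gives QQ* = J Q*Q J and (iii) follows by
   uniqueness of square roots. Conversely, (iii) says that the idempotent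
   T = JQ*J satisfies TT* = QQ* and T*T = Q*Q, so T has the range and the kernel
   of Q, and T = Q. *)
Require Import Defs.
From HB Require Import structures.
From mathcomp Require Import all_boot all_order all_algebra.
From mathcomp Require Import boolp classical_sets reals topology normedtype.
From mathcomp Require Import sequences.
From mathcomp Require Import complex.
From mathcomp Require Import ring lra.
Import Order.TTheory GRing.Theory Num.Theory.
Import numFieldNormedType.Exports.
Set Implicit Arguments.
Unset Strict Implicit.
Unset Printing Implicit Defensive.
Local Open Scope ring_scope.
Local Open Scope complex_scope.
Local Open Scope classical_set_scope.

(** * Norms with values in the real field *)

Section RealNorm.
Variables (R : realType) (V : normedModType R[i]).
Implicit Types x y : V.

(** The library norm takes values in [R[i]], which is only partially ordered; its real part moves
    the estimates to [R], where [lra] applies. *)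
Definition rnorm x : R := complex.Re `|x|.

Lemma rnormE x : (rnorm x)%:C = `|x|.
Proof. by rewrite RRe_real // normr_real. Qed.

Lemma rnorm_ge0 x : 0 <= rnorm x.
Proof. by rewrite -ler0c rnormE. Qed.

Lemma rnormD x y : rnorm (x + y) <= rnorm x + rnorm y.
Proof. by rewrite -lecR rmorphD /= !rnormE ler_normD. Qed.

Lemma rnormN x : rnorm (- x) = rnorm x.
Proof. by rewrite /rnorm normrN. Qed.

Lemma rnormBC x y : rnorm (x - y) = rnorm (y - x).
Proof. by rewrite -rnormN opprB. Qed.

Lemma rnormZr (t : R) x : 0 <= t -> rnorm (t%:C *: x) = t * rnorm x.
Proof.
move=> t0; apply: complexI; rewrite rmorphM /= !rnormE normrZ ger0_norm //.
by rewrite ler0c.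
Qed.

Lemma rnormZ_unit (l : R[i]) x : `|l| = 1 -> rnorm (l *: x) = rnorm x.
Proof. by move=> l1; rewrite /rnorm normrZ l1 mul1r. Qed.

Lemma rnorm0 : rnorm (0 : V) = 0.
Proof. by rewrite /rnorm normr0. Qed.

Lemma rnorm_eq0 x : rnorm x = 0 -> x = 0.
Proof. by move=> h; apply/normr0_eq0; rewrite -rnormE h. Qed.

Lemma rnorm_gt0 x : x <> 0 -> 0 < rnorm x.
Proof.
by rewrite lt_def rnorm_ge0 andbT => x0; apply/eqP => /rnorm_eq0.
Qed.

End RealNorm.

(** * Sequences with geometrically decreasing increments *)

Section GeometricCauchy.
Variable R : realType.

Lemma expr_small (q e : R) : 0 <= q -> q < 1 -> 0 < e -> exists n, q ^+ n < e.
Proof.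
move=> q0 q1 e0; have /cvg_expr/cvgrPdist_lt/(_ e e0)[n _ hn] : `|q| < 1.
  by rewrite ger0_norm.
by exists n; have := hn n (leqnn n); rewrite sub0r normrN ger0_norm ?exprn_ge0.
Qed.

(** The increments telescope into a geometric series, so the sequence is Cauchy; the tail of the
    series gives the rate, which passes to the limit. *)
Lemma rnorm_geometric_cvg (V : completeNormedModType R[i]) (u : nat -> V)
    (C q : R) : 0 <= q -> q < 1 ->
  (forall n, rnorm (u n.+1 - u n) <= C * q ^+ n) ->
  exists l : V, forall n, rnorm (l - u n) <= C / (1 - q) * q ^+ n.
Proof.
move=> q0 q1 hu.
have q1' : 0 < 1 - q by lra.
have C0 : 0 <= C.
  by move: (hu 0%N); rewrite expr0 mulr1; apply: le_trans; apply: rnorm_ge0.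
have tele n k : rnorm (u (n + k)%N - u n) <= C / (1 - q) * q ^+ n.
  (* The sharper bound, a partial sum of the series, is the one that induction on [k] can carry. *)
  suff h : rnorm (u (n + k)%N - u n) <= C / (1 - q) * (q ^+ n - q ^+ (n + k)).
    apply: le_trans h _; apply: ler_wpM2l; first by rewrite divr_ge0 // ltW.
    by rewrite lerBlDr lerDl exprn_ge0.
  elim: k => [|k IH]; first by rewrite addn0 !subrr mulr0 rnorm0.
  rewrite addnS -(subrKA (u (n + k)%N)); apply: le_trans (rnormD _ _) _.
  apply: le_trans (lerD (hu _) IH) _.
  rewrite exprS [leRHS](_ : _ = C * q ^+ (n + k) +
    C / (1 - q) * (q ^+ n - q ^+ (n + k))) //.
  by field; rewrite gt_eqF.
have tele2 n m : (n <= m)%N -> rnorm (u m - u n) <= C / (1 - q) * q ^+ n.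
  by move=> /subnKC <-.
have small e : 0 < e -> exists n, C / (1 - q) * q ^+ n < e.
  move=> e0; have D0 : 0 < C / (1 - q) + 1 by rewrite ltr_wpDl // divr_ge0 // ltW.
  have [n hn] := @expr_small q (e / (C / (1 - q) + 1)) q0 q1 (divr_gt0 e0 D0).
  exists n; rewrite -[ltRHS](@divfK _ (C / (1 - q) + 1)) ?gt_eqF // mulrC.
  apply: le_lt_trans (_ : q ^+ n * (C / (1 - q) + 1) < _).
    by rewrite mulrDr mulr1 lerDl exprn_ge0.
  by rewrite ltr_pM2r.
have cu : cvgn u.
  apply: cauchy_cvg; apply: cauchy_exP => e e0.
  have eR : e = (complex.Re e)%:C by rewrite RRe_real // gtr0_real.
  have e0' : 0 < complex.Re e by rewrite -ltcR -eR.
  have [n hn] := small _ e0'.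
  exists (u n); exists n => // m /= nm.
  rewrite -ball_normE /= -rnormE eR ltcR rnormBC.
  exact: le_lt_trans (tele2 _ _ nm) hn.
exists (lim (u @ \oo)) => n.
apply/ler_addgt0Pr => e e0.
have e0' : 0 < e%:C by rewrite ltcR.
have /cvgrPdist_lt/(_ _ e0')[N _ hN] := cu.
pose m := maxn N n.
have hm : rnorm (lim (u @ \oo) - u m) < e.
  by rewrite -ltcR rnormE; apply: hN; rewrite /= leq_maxl.
rewrite -(subrKA (u m)) addrC; apply: le_trans (rnormD _ _) _.
by apply: lerD (ltW hm); rewrite tele2 // leq_maxr.
Qed.

End GeometricCauchy.

(** * Continuity of the inner product, by polarization *)

Section InnerProductBound.
Variables (R : realType) (A : cstarAlgType R) (H : hilbertModType A).
Implicit Types x y : H.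

Lemma rnorm_sqr x : rnorm x ^+ 2 = rnorm (hip x x).
Proof. by apply: complexI; rewrite rmorphXn /= !rnormE hip_norm. Qed.

Lemma conj_real (t : R) : Num.conj t%:C = t%:C :> R[i].
Proof. by rewrite conj_Creal //; apply/complex_realP; exists t. Qed.

Lemma conj_i : Num.conj 'i = - 'i :> R[i].
Proof. by apply/eqP; rewrite eq_complex /= oppr0 !eqxx. Qed.

Lemma hip_parallelogram x y :
  hip (x + y) (x + y) - hip (x - y) (x - y) = (hip x y + hip y x) *+ 2.
Proof.
rewrite !hipDl !hipDr !hipNl !hipNr opprK.
rewrite [_ + hip y y]addrC [- _ + hip y y]addrC addrACA.
rewrite [X in _ - X]addrACA -(opprD (hip x y)) opprB [LHS]addrC subrKA.
by rewrite mulr2n.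
Qed.

Lemma hip_polarization x y :
  4%:R *: hip x y = hip (x + y) (x + y) - hip (x - y) (x - y)
    + (- 'i) *: (hip (x + 'i *: y) (x + 'i *: y)
    - hip (x - 'i *: y) (x - 'i *: y)).
Proof.
rewrite !hip_parallelogram hipZl hipZr conj_i -scalerMnr scalerDr !scalerA.
rewrite !mulNr !mulrN -expr2 sqr_i !opprK scale1r scaleN1r.
by rewrite -mulrnDl addrACA subrr addr0 -mulr2n -mulrnA scaler_nat.
Qed.

(** Each of the four squares in the polarization identity is bounded by the right-hand side; the
    factor 4 on its left absorbs their number. *)
Lemma rnorm_hip_sqr_le x y : rnorm (hip x y) <= (rnorm x + rnorm y) ^+ 2.
Proof.
have i1 : `|'i : R[i]| = 1 by rewrite normc_def /= expr0n add0r expr1n sqrtr1.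
have sq (z : H) : rnorm z <= rnorm x + rnorm y ->
    rnorm (hip z z) <= (rnorm x + rnorm y) ^+ 2.
  by move=> h; rewrite -rnorm_sqr lerXn2r // nnegrE // ?addr_ge0 ?rnorm_ge0.
have [b1 b2 b3 b4] : [/\ rnorm (x + y) <= rnorm x + rnorm y,
    rnorm (x - y) <= rnorm x + rnorm y,
    rnorm (x + 'i *: y) <= rnorm x + rnorm y &
    rnorm (x - 'i *: y) <= rnorm x + rnorm y].
  split; apply: le_trans (rnormD _ _) _; rewrite ?rnormN ?rnormZ_unit //.
have /(congr1 (@rnorm R A)) := hip_polarization x y.
rewrite -[4%:R](rmorph_nat (real_complex R)) rnormZr // => e.
rewrite -(ler_pM2l (_ : 0 < 4%:R :> R)) // e scalerBr.
set u := (- 'i) *: _; set v := (- 'i) *: _.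
have hu : rnorm u <= (rnorm x + rnorm y) ^+ 2 by rewrite rnormZ_unit ?normrN ?sq.
have hv : rnorm v <= (rnorm x + rnorm y) ^+ 2 by rewrite rnormZ_unit ?normrN ?sq.
have := (rnormD (hip (x + y) (x + y) - hip (x - y) (x - y)) (u - v),
  rnormD (hip (x + y) (x + y)) (- hip (x - y) (x - y)), rnormD u (- v)).
rewrite !rnormN => -[[]].
by have := (sq _ b1, sq _ b2) => -[]; lra.
Qed.

(** Once [x] is scaled to the norm of [y], the previous bound reads 4|y|^2. This is Cauchy-Schwarz
    up to a constant, obtained without the order of [A]. *)
Lemma rnorm_hip_le x y : rnorm (hip x y) <= 4 * rnorm x * rnorm y.
Proof.
have [->|/eqP/rnorm_gt0 x0] := eqVneq x 0.
  by rewrite hip0l !rnorm0 !(mulr0, mul0r).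
pose s := rnorm y / rnorm x.
have [->|/eqP/rnorm_gt0 y0] := eqVneq y 0; first by rewrite hip0r !rnorm0 mulr0.
have s0 : 0 < s by rewrite divr_gt0.
have := rnorm_hip_sqr_le (s%:C *: x) y.
have es : s * rnorm x = rnorm y by rewrite divfK ?gt_eqF.
rewrite hipZl conj_real !(rnormZr _ (ltW s0)) es.
move=> h; rewrite -(ler_pM2l s0); apply: le_trans h _.
have -> : s * (4 * rnorm x * rnorm y) = 4 * (s * rnorm x) * rnorm y by ring.
by rewrite es; nra.
Qed.

End InnerProductBound.

(** * Automatic boundedness of adjointable operators *)

Section UniformBoundedness.
Variables (R : realType) (A : cstarAlgType R) (H : hilbertModType A).
Implicit Types (x y z : H) (T : 'L(H)).

(** With u = (r/|z|) z, the values of [hip z] at x + u and x - u differ by 2 [hip z u], of norm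
    2r|z|, so one of the two points serves. *)
Lemma hip_gliding_hump z x (r : R) : 0 < r -> z <> 0 ->
  exists x', rnorm (x' - x) <= r /\ r * rnorm z <= rnorm (hip z x').
Proof.
move=> r0 /rnorm_gt0 z0.
pose u := (r / rnorm z)%:C *: z.
have c0 : 0 <= r / rnorm z by rewrite divr_ge0 ?ltW.
have ru : rnorm u = r by rewrite rnormZr // divfK ?gt_eqF.
have rfu : rnorm (hip z u) = r * rnorm z.
  rewrite hipZr rnormZr // -rnorm_sqr; field; by rewrite gt_eqF.
have e2 : (2%:R : R)%:C *: hip z u = hip z (x + u) - hip z (x - u).
  rewrite !hipDr hipNr opprD opprK addrACA subrr add0r -mulr2n.
  by rewrite -[RHS]scaler_nat (rmorph_nat (real_complex R)).
have := rnormD (hip z (x + u)) (- hip z (x - u)).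
rewrite -e2 rnormZr // rfu rnormN => h.
have [h1|h1] := leP (r * rnorm z) (rnorm (hip z (x + u))).
  by exists (x + u); rewrite addrC addKr ru.
by exists (x - u); rewrite addrC addKr rnormN ru; split => //; lra.
Qed.

(* Hellinger-Toeplitz by a gliding hump: were [T] unbounded, there would be
   [y n] with [|T (y n)| > 32 ^ n |y n|] and a point [l] at which
   [hip (T (y n)) l = hip (y n) (T^* l)] is too large for infinitely many n. *)
Lemma adjointable_bounded T :
  exists2 M, 0 <= M & forall x, rnorm (T x) <= M * rnorm x.
Proof.
apply: contrapT => noM.
have /choice[y hy] n : exists y, 32%:R ^+ n * rnorm y < rnorm (T y).
  apply: contrapT => /forallNP h; apply: noM.
  exists (32%:R ^+ n) => [|x]; first exact: exprn_ge0.
  by have /negP := h x; rewrite -leNgt.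
have Ty0 n : T (y n) <> 0.
  move=> e; have := hy n; rewrite e rnorm0 => /(le_lt_trans _) h.
  by have := h _ (mulr_ge0 (exprn_ge0 n (ler0n _ _)) (rnorm_ge0 _)); rewrite ltxx.
(* The moves after [u n.+1] add up to at most q^n/15, so they change the value there by at most 4/15
   of the hump q^n |T (y n)|, and more than half of it survives at [l]. The growth 32^n of [y] then
   still beats q^n, leaving 2^n. *)
pose q : R := 16%:R^-1.
have q0 : 0 < q by rewrite invr_gt0.
have /choice[step hstep] (p : nat * H) :=
  hip_gliding_hump p.2 (exprn_gt0 p.1 q0) (Ty0 p.1).
pose fix u n : H := if n is m.+1 then step (m, u m) else 0.
have hu n : rnorm (u n.+1 - u n) <= 1 * q ^+ n.
  by rewrite mul1r; case: (hstep (n, u n)).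
have [||l hl] := rnorm_geometric_cvg _ _ hu; rewrite ?ltW ?invf_lt1 ?ltr1n //.
pose D := rnorm (adj_adj T l).
have D0 : 0 <= D by exact: rnorm_ge0.
have bound n : 2%:R ^+ n <= 8 * D.
  have hn : q ^+ n * rnorm (T (y n)) <= rnorm (hip (T (y n)) (u n.+1)).
    by case: (hstep (n, u n)).
  have hln := hl n.+1.
  have z0 := rnorm_gt0 (Ty0 n).
  have := rnormD (hip (T (y n)) l) (- hip (T (y n)) (l - u n.+1)).
  rewrite -{1}hipNr -hipDr opprB addrC subrK rnormN => h1.
  have h2 := rnorm_hip_le (T (y n)) (l - u n.+1).
  have h3 := rnorm_hip_le (y n) (adj_adj T l).
  rewrite -adj_funP in h3.
  have h4 := hy n.
  rewrite exprS in hln; set a := q ^+ n in hn hln; set b := 32%:R ^+ n in h4.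
  have -> : 2%:R ^+ n = b * a by rewrite -exprMn; congr (_ ^+ _); rewrite /q; field.
  have a0 : 0 < a by exact: exprn_gt0.
  have b0 : 0 < b by exact: exprn_gt0.
  have hln' : rnorm (l - u n.+1) <= a / 15.
    apply: le_trans hln _; suff -> : 1 / (1 - q) * (q * a) = a / 15 by [].
    by rewrite /q; field.
  have z0' := rnorm_ge0 (T (y n)).
  have h5 : a * rnorm (T (y n)) / 2 <= rnorm (hip (T (y n)) l).
    have : rnorm (T (y n)) * rnorm (l - u n.+1) <= rnorm (T (y n)) * (a / 15).
      by rewrite ler_wpM2l.
    have := mulr_gt0 a0 z0; lra.
  have h6 : a * rnorm (T (y n)) <= 8 * D * rnorm (y n) by rewrite -/D in h3; lra.
  rewrite -(ler_pM2r z0).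
  have : b * (a * rnorm (T (y n))) <= b * (8 * D * rnorm (y n)) by rewrite ler_pM2l.
  have : 8 * D * (b * rnorm (y n)) <= 8 * D * rnorm (T (y n)).
    by apply: ler_wpM2l; [exact: mulr_ge0 | exact: ltW].
  lra.
have D1 : 0 < 8 * D + 1 by lra.
have [|||n] := @expr_small R 2^-1 (8 * D + 1)^-1;
  [lra | lra | by rewrite invr_gt0 |].
rewrite exprVn ltf_pV2 ?posrE ?exprn_gt0 // => /ltW /le_trans /(_ (bound n)); lra.
Qed.

End UniformBoundedness.

(** * Operator bounds and completeness of the adjointable operators *)

Section AdjointableCompleteness.
Variables (R : realType) (A : cstarAlgType R) (H : hilbertModType A).
Implicit Types (x y z : H) (S T U : 'L(H)) (M N e : R).

(** A relational substitute for the operator norm. The adjoint is bounded along with the operator,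
    so that limits of adjoints are available too. *)
Definition bounded_by T M := 0 <= M /\
  forall x, rnorm (T x) <= M * rnorm x /\ rnorm (star T x) <= M * rnorm x.

Lemma ex_bounded_by T : exists M, 0 < M /\ bounded_by T M.
Proof.
have [M M0 hM] := adjointable_bounded T.
have [N N0 hN] := adjointable_bounded (star T).
exists (M + N + 1); split; first lra.
split=> [|x]; first lra.
have x0 := rnorm_ge0 x.
by split; [apply: le_trans (hM x) _|apply: le_trans (hN x) _];
  apply: ler_wpM2r => //; lra.
Qed.

Lemma bounded_by_le T M N : bounded_by T M -> M <= N -> bounded_by T N.
Proof.
move=> [M0 h] MN; split; first exact: le_trans MN.
by move=> x; have [h1 h2] := h x; split; [apply: le_trans h1 _|apply: le_trans h2 _];
  rewrite ler_wpM2r ?rnorm_ge0.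
Qed.

Lemma bounded_by_star T M : bounded_by T M -> bounded_by (star T) M.
Proof. by case=> M0 h; split=> // x; have [] := h x; rewrite starK. Qed.

Lemma star0 : star (0 : 'L(H)) = 0.
Proof. by apply: (addIr (star 0)); rewrite -starD !add0r. Qed.

Lemma bounded_by0 M : 0 <= M -> bounded_by 0 M.
Proof.
by move=> M0; split=> // x; rewrite star0 /= rnorm0 mulr_ge0 ?rnorm_ge0.
Qed.

Lemma bounded_byD S T M N :
  bounded_by S M -> bounded_by T N -> bounded_by (S + T) (M + N).
Proof.
move=> [M0 hS] [N0 hT]; split=> [|x]; first exact: addr_ge0.
have [[h1 h2] [h3 h4]] := (hS x, hT x).
rewrite starD /= mulrDl; split; apply: le_trans (rnormD _ _) _; exact: lerD.
Qed.

Lemma bounded_byM S T M N :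
  bounded_by S M -> bounded_by T N -> bounded_by (S * T) (M * N).
Proof.
move=> [M0 hS] [N0 hT]; split=> [|x]; first exact: mulr_ge0.
rewrite -adjointable_smulE starM adjointable_smulE /=; split.
  by apply: le_trans (proj1 (hS _)) _; rewrite -mulrA ler_wpM2l //; case: (hT x).
apply: le_trans (proj2 (hT _)) _.
by rewrite [M * N]mulrC -mulrA ler_wpM2l //; case: (hS x).
Qed.

Lemma starZr (t : R) T : star (t%:C *: T) = t%:C *: star T.
Proof. by rewrite starZ conj_real. Qed.

Lemma bounded_byZ T M (t : R) :
  0 <= t -> bounded_by T M -> bounded_by (t%:C *: T) (t * M).
Proof.
move=> t0 [M0 h]; split=> [|x]; first exact: mulr_ge0.
rewrite starZr; have [h1 h2] := h x.
by split; rewrite -mulrA [rnorm _]rnormZr // ler_wpM2l.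
Qed.

Lemma starN T : star (- T) = - star T.
Proof. by rewrite -scaleN1r starZ rmorphN1 scaleN1r. Qed.

Lemma starB S T : star (S - T) = star S - star T.
Proof. by rewrite starD starN. Qed.

Lemma bounded_byN T M : bounded_by T M -> bounded_by (- T) M.
Proof.
case=> M0 h; split=> // x; rewrite starN /= !rnormN.
exact: h.
Qed.

Lemma bounded_byB S T M N :
  bounded_by S M -> bounded_by T N -> bounded_by (S - T) (M + N).
Proof. by move=> hS hT; apply: bounded_byD => //; apply: bounded_byN. Qed.

Lemma bounded_by_eq0 T : (forall e, 0 < e -> bounded_by T e) -> T = 0.
Proof.
move=> h; apply: adjointableP => x; apply: rnorm_eq0; apply/eqP.
rewrite eq_le rnorm_ge0 andbT; apply/ler_addgt0Pr => e e0; rewrite add0r.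
have x1 : 0 < rnorm x + 1 by rewrite ltr_wpDl ?rnorm_ge0.
have [_ /(_ x)[h1 _]] := h _ (divr_gt0 e0 x1).
apply: le_trans h1 _; rewrite mulrAC ler_pdivrMr //.
by have := rnorm_ge0 x; nra.
Qed.

(** The sequence and its adjoints converge pointwise at the same rate; the adjunction identity
    passes to the limits and makes them an adjointable operator. *)
Lemma adjointable_geometric_cvg (u : nat -> 'L(H)) M :
  (forall n, bounded_by (u n.+1 - u n) (M * 2^-1 ^+ n)) ->
  exists T, forall n, bounded_by (T - u n) (2 * M * 2^-1 ^+ n).
Proof.
move=> hu.
have M0 : 0 <= M by case: (hu 0%N); rewrite mulr1.
have [q0 q1] : 0 <= 2^-1 :> R /\ 2^-1 < 1 :> R by split; lra.
have bd x : exists y, forall n, rnorm (y - u n x) <= 2 * M * rnorm x * 2^-1 ^+ n.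
  have [n|y hy] := @rnorm_geometric_cvg R H (fun n => u n x) (M * rnorm x) _ q0 q1.
    by have [_ /(_ x)[h _]] := hu n; apply: le_trans h _; rewrite mulrAC.
  exists y => n; apply: le_trans (hy n) _.
  by rewrite le_eqVlt; apply/orP; left; apply/eqP; field.
have bd' x : exists y, forall n,
    rnorm (y - star (u n) x) <= 2 * M * rnorm x * 2^-1 ^+ n.
  have [n|y hy] :=
    @rnorm_geometric_cvg R H (fun n => star (u n) x) (M * rnorm x) _ q0 q1.
    have [_ /(_ x)[_ h]] := hu n; apply: le_trans _ (le_trans h _).
      by rewrite starB.
    by rewrite mulrAC.
  exists y => n; apply: le_trans (hy n) _.
  by rewrite le_eqVlt; apply/orP; left; apply/eqP; field.
have [f hf] := choice bd; have [g hg] := choice bd'.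
have fg x y : hip (f x) y = hip x (g y).
  apply/eqP; rewrite -subr_eq0; apply/eqP/rnorm_eq0/eqP.
  rewrite eq_le rnorm_ge0 andbT; apply/ler_addgt0Pr => e e0; rewrite add0r.
  (* Two error terms, each at most 4 * 2M|x||y| 2^-n; the summand 1 makes [K] positive. *)
  pose K := 16 * M * rnorm x * rnorm y + 1.
  have K0 : 0 < K by rewrite ltr_wpDl ?mulr_ge0 ?rnorm_ge0.
  have [n hn] := expr_small q0 q1 (divr_gt0 e0 K0).
  have -> : hip (f x) y - hip x (g y) =
      hip (f x - u n x) y - hip x (g y - star (u n) y).
    by rewrite hipDl hipNl hipDr hipNr adj_funP opprD opprK addrACA addNr addr0.
  apply: le_trans (rnormD _ _) _; rewrite rnormN.
  have := (rnorm_hip_le (f x - u n x) y, rnorm_hip_le x (g y - star (u n) y)).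
  move=> [h1 h2].
  have h3 := ler_wpM2r (rnorm_ge0 y) (hf x n).
  have h4 := ler_wpM2l (rnorm_ge0 x) (hg y n).
  rewrite ltr_pdivlMr // in hn.
  have : 0 <= 2^-1 ^+ n :> R by rewrite exprn_ge0.
  rewrite /K in hn; lra.
exists (Adjointable fg) => n; split=> [|x]; first by rewrite !mulr_ge0 ?exprn_ge0.
split; first by apply: le_trans (hf x n) _; rewrite mulrAC.
rewrite starB.
by apply: le_trans (hg x n) _; rewrite mulrAC.
Qed.

End AdjointableCompleteness.

(** * Closed conditions on operators and the contraction principle *)

Section Contraction.
Variables (R : realType) (A : cstarAlgType R) (H : hilbertModType A).
Implicit Types (S T U a x z : 'L(H)) (M e : R) (D : 'L(H) -> Prop).

Definition adjointable_closed D :=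
  forall T, (forall e, 0 < e -> exists S, D S /\ bounded_by (T - S) e) -> D T.

Lemma adjointable_closedI D1 D2 : adjointable_closed D1 ->
  adjointable_closed D2 -> adjointable_closed (fun T => D1 T /\ D2 T).
Proof.
by move=> c1 c2 T h; split; [apply: c1|apply: c2] => e /h [S [[d1 d2] hS]];
  exists S.
Qed.

Lemma adjointable_closed_bounded M :
  adjointable_closed (fun T => bounded_by T M).
Proof.
move=> T h.
have M0 : 0 <= M by have [|S [[]]] := h 1.
split=> // x.
suff hh e : 0 < e ->
    rnorm (T x) <= M * rnorm x + e /\ rnorm (star T x) <= M * rnorm x + e.
  by split; apply/ler_addgt0Pr => e /hh[].
move=> e0; have x1 : 0 < rnorm x + 1 by rewrite ltr_wpDl ?rnorm_ge0.
have [S [hS hTS]] := h _ (divr_gt0 e0 x1).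
have [_ /(_ x)] : bounded_by T (M + e / (rnorm x + 1)).
  by rewrite -(subrK S T) addrC; exact: bounded_byD.
rewrite mulrDl.
have h3 : e / (rnorm x + 1) * rnorm x <= e.
  by rewrite mulrAC ler_pdivrMr //; have := rnorm_ge0 x; nra.
by case=> h1 h2; split; lra.
Qed.

Lemma adjointable_closed_comm z : adjointable_closed (fun T => GRing.comm z T).
Proof.
move=> T h; apply/eqP; rewrite -subr_eq0; apply/eqP/bounded_by_eq0 => e e0.
have [M [M0 hz]] := ex_bounded_by z.
have M2 : 0 < 2 * M by rewrite mulr_gt0.
have [S [zS hTS]] := h _ (divr_gt0 e0 M2).
have -> : z * T - T * z = z * (T - S) - (T - S) * z.
  by rewrite mulrBr mulrBl zS opprB addrA subrK.
have -> : e = M * (e / (2 * M)) + (e / (2 * M)) * M by field; rewrite gt_eqF.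
by apply: bounded_byB; apply: bounded_byM.
Qed.

(** Everything constructed from [a] below stays in its bicommutant; this supplies the commutations
    that a functional calculus would give. *)
Definition bicommutant a T := forall z, GRing.comm z a -> GRing.comm z T.

Lemma adjointable_closed_bicommutant a : adjointable_closed (bicommutant a).
Proof.
move=> T h z za; apply: adjointable_closed_comm => e /h [S [dS hS]].
by exists S; split=> //; apply: dS.
Qed.

Lemma adjointable_closed_selfadjoint : adjointable_closed (fun T => star T = T).
Proof.
move=> T h; apply/eqP; rewrite -subr_eq0; apply/eqP/bounded_by_eq0 => e e0.
have [|S [sS hS]] := h (e / 2); first by rewrite divr_gt0.
have -> : star T - T = star (T - S) - (T - S).
  by rewrite starB sS opprB addrA subrK.
by rewrite (splitr e); apply: bounded_byB => //; apply: bounded_by_star.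
Qed.

(** The iterates of [F] from 0 stay in [D] and converge geometrically. The predicate [D] hands
    selfadjointness, commutation and bounds on to the fixed point, and confines the contraction
    estimate to a ball. *)
Lemma adjointable_fixpoint D M (F : 'L(H) -> 'L(H)) :
  adjointable_closed D -> D 0 -> (forall S, D S -> D (F S)) ->
  bounded_by (F 0) M ->
  (forall S T N, D S -> D T -> bounded_by (S - T) N ->
     bounded_by (F S - F T) (2^-1 * N)) ->
  exists T, D T /\ F T = T.
Proof.
move=> cD D0 FD F0 Fc; pose u n := iter n F 0.
have Du n : D (u n) by elim: n => //= n; exact: FD.
have hu n : bounded_by (u n.+1 - u n) (M * 2^-1 ^+ n).
  elim: n => [|n IH]; first by rewrite mulr1 subr0.
  by rewrite exprS mulrCA; apply: Fc IH.
have [T hT] := adjointable_geometric_cvg hu.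
have M0 : 0 <= M by case: F0.
have small e : 0 < e -> exists n, 2 * M * 2^-1 ^+ n <= e.
  move=> e0; have K0 : 0 < 2 * M + 1 by lra.
  have [||n hn] := @expr_small R 2^-1 (e / (2 * M + 1)) _ _ (divr_gt0 e0 K0);
    [lra | lra |].
  exists n; rewrite ltr_pdivlMr // in hn.
  by have := @exprn_ge0 R n 2^-1; lra.
have DT : D T.
  apply: cD => e /small [n hn]; exists (u n); split=> //.
  exact: bounded_by_le (hT n) hn.
exists T; split=> //; apply/eqP; rewrite -subr_eq0; apply/eqP/bounded_by_eq0 => e e0.
have [n hn] := small _ e0.
have -> : F T - T = (F T - F (u n)) - (T - u n.+1) by rewrite opprB addrA subrK.
apply: bounded_by_le (bounded_byB (Fc _ _ _ DT (Du n) (hT n)) (hT n.+1)) _.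
by rewrite exprS; lra.
Qed.

End Contraction.

(** * Inverses and roots near the identity *)

Section SquareRoots.
Variables (R : realType) (A : cstarAlgType R) (H : hilbertModType A).
Implicit Types (S T U a x z : 'L(H)) (M e : R).

Definition inverse_of a T := a * T = 1 /\ T * a = 1.

Lemma commrZ z T (l : R[i]) : GRing.comm z T -> GRing.comm z (l *: T).
Proof. by move=> h; rewrite /GRing.comm adjointableMZl adjointableMZr h. Qed.

Lemma star1 : star (1 : 'L(H)) = 1.
Proof. exact: adjointableP. Qed.

Lemma starMr S T : star (S * T) = star T * star S.
Proof. exact: starM. Qed.

Lemma bounded_by1 : bounded_by (1 : 'L(H)) 1.
Proof. by split=> // x; rewrite star1 /= mul1r. Qed.

(** The inverse is the fixed point of T -> 1 + xT; lying in the bicommutant of [x], it is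
    two-sided. *)
Lemma neumann x : bounded_by x 2^-1 -> exists w, inverse_of (1 - x) w.
Proof.
move=> hx.
have [||||T [cT e]] := @adjointable_fixpoint R A H _ 1 (fun T => 1 + x * T)
  (@adjointable_closed_bicommutant R A H x).
- by move=> z _; rewrite /GRing.comm mulr0 mul0r.
- move=> S cS z zx; apply: commrD; first exact: commr1.
  by apply: commrM => //; apply: cS.
- by rewrite mulr0 addr0; exact: bounded_by1.
- move=> S T N _ _ hST; rewrite opprD addrACA subrr add0r -mulrBr.
  exact: bounded_byM.
exists T; have e' : (1 - x) * T = 1 by rewrite mulrBl mul1r -{1}e addrK.
by split=> //; rewrite -[RHS]e' mulrBl mulrBr mul1r mulr1 (cT x) //.
Qed.

(** The equation amounts to y = (x + y^2)/2, whose right-hand side preserves the ball of radius 1/2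
    and contracts it by 1/2. The bound on [y] allows the lemma to be applied again to [y]. *)
Lemma sqrt_one_minus x : bounded_by x 2^-1 -> star x = x ->
  exists y, [/\ star y = y, bicommutant x y, bounded_by y 2^-1 &
    (1 - y) ^+ 2 = 1 - x].
Proof.
move=> hx sx.
pose D T := star T = T /\ (bicommutant x T /\ bounded_by T 2^-1).
have h0 : 0 <= 2^-1 :> R by lra.
have [|||||y [[sy [cy by_]] e]] := @adjointable_fixpoint R A H D 2^-1
  (fun T => 2^-1%:C *: (x + T * T)).
- apply: adjointable_closedI; first exact: adjointable_closed_selfadjoint.
  apply: adjointable_closedI; first exact: adjointable_closed_bicommutant.
  exact: adjointable_closed_bounded.
- split; last first.
    by split; [move=> z _; rewrite /GRing.comm mulr0 mul0r|exact: bounded_by0].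
  by rewrite -(subrr x) starB sx.
- move=> S [sS [cS bS]]; split; first by rewrite starZr starD starMr sS sx.
  split=> [z zx|].
    by apply/commrZ/commrD => //; apply: commrM; apply: cS.
  apply: bounded_by_le (bounded_byZ h0 (bounded_byD hx (bounded_byM bS bS))) _.
  lra.
- rewrite mulr0 addr0; apply: bounded_by_le (bounded_byZ h0 hx) _; lra.
- move=> S T N [_ [_ bS]] [_ [_ bT]] hST.
  rewrite -scalerBr opprD addrACA subrr add0r; apply: bounded_byZ => //.
  have -> : S * S - T * T = S * (S - T) + (S - T) * T.
    by rewrite mulrBr mulrBl addrA subrK.
  apply: bounded_by_le (bounded_byD (bounded_byM bS hST) (bounded_byM hST bT)) _.
  lra.
exists y; split=> //.
have e2 : y + y = x + y * y.
  rewrite -{1 2}e -scalerDl -rmorphD /= (_ : 2^-1 + 2^-1 = 1 :> R); last lra.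
  by rewrite scale1r.
rewrite expr2 mulrBr mulr1 mulrBl mul1r opprB addrCA -addrA -opprD e2 opprD.
by rewrite (addrA 1) addrCA subrr addr0.
Qed.

(** Fourth roots are the goal because the square of a selfadjoint fourth root is a square root that
    is visibly positive. *)
Lemma root4_one_minus x : bounded_by x 2^-1 -> star x = x ->
  exists y, [/\ star y = y, bicommutant x y & y ^+ 4 = 1 - x].
Proof.
move=> hx sx; have [y [sy cy by_ ey]] := sqrt_one_minus hx sx.
have [z [sz cz _ ez]] := sqrt_one_minus by_ sy.
exists (1 - z); split; first by rewrite starB star1 sz.
  by move=> t tx; apply: commrB; [exact: commr1|apply/cz/cy].
by rewrite -[4%N]/(2 * 2)%N exprM ez ey.
Qed.

End SquareRoots.

(** * Inverses and the resolvent of a selfadjoint operator *)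

Section Resolvents.
Variables (R : realType) (A : cstarAlgType R) (H : hilbertModType A).
Local Notation I := (1 : 'L(H)).
Implicit Types (x y : H) (S T U a b h v w z : 'L(H)) (M e t : R).

Lemma inverse_ofM a b v w :
  inverse_of a v -> inverse_of b w -> inverse_of (a * b) (w * v).
Proof.
move=> [av va] [bw wb]; split.
  by rewrite mulrA -(mulrA a) bw mulr1.
by rewrite mulrA -(mulrA w) va mulr1.
Qed.

Lemma inverse_ofZ (l : R[i]) a v :
  l != 0 -> inverse_of a v -> inverse_of (l *: a) (l^-1 *: v).
Proof.
move=> l0 [av va].
by split; rewrite adjointableMZl adjointableMZr scalerA ?mulfV ?mulVf // scale1r.
Qed.

Lemma inverse_of_star a v : inverse_of a v -> inverse_of (star a) (star v).
Proof. by case=> av va; split; rewrite -starMr ?va ?av star1. Qed.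

Lemma inverse_of_uniq a v w : inverse_of a v -> inverse_of a w -> v = w.
Proof. by move=> [av va] [aw wa]; rewrite -[v]mulr1 -aw mulrA va mul1r. Qed.

Lemma inverse_of_bicommutant a v : inverse_of a v -> bicommutant a v.
Proof.
move=> [av va] z za; rewrite /GRing.comm.
by rewrite -[LHS]mul1r -va -mulrA (mulrA a) -za -(mulrA z) av mulr1.
Qed.

Lemma inverse_of_root a v n :
  inverse_of (a ^+ n.+1) v -> inverse_of a (a ^+ n * v).
Proof.
move=> hv; have av : GRing.comm a v.
  by apply: (inverse_of_bicommutant hv); exact: commrX.
by rewrite /inverse_of mulrA -exprS -mulrA -av mulrA -exprSr hv.1.
Qed.

Lemma comm_scalar (l : R[i]) z : GRing.comm z (l *: I).
Proof. by apply: commrZ; exact: commr1. Qed.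

Lemma bounded_by_i T M : bounded_by T M -> bounded_by ('i *: T) M.
Proof.
have i1 : `|'i : R[i]| = 1 by rewrite normc_def /= expr0n add0r expr1n sqrtr1.
by move=> [M0 hT]; split=> // x; rewrite starZ conj_i /= !rnormZ_unit ?normrN //.
Qed.

Lemma bounded_by_scale T M (t : R) :
  bounded_by T M -> bounded_by (t%:C *: T) (`|t| * M).
Proof.
move=> hT; have [t0|t0] := leP 0 t.
  by rewrite ger0_norm //; exact: bounded_byZ.
rewrite ltr0_norm // -[t in t%:C]opprK rmorphN scaleNr.
by apply/bounded_byN/bounded_byZ => //; lra.
Qed.

(* [a] and [star a] commute, so they have the same norm at [y], and their
   difference is [2it]. *)
Lemma selfadjoint_resolvent_bound h t y : star h = h -> 0 <= t ->
  let a := h + ('i * t%:C) *: I in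
  t * rnorm y <= rnorm (a y) /\ t * rnorm y <= rnorm (star a y).
Proof.
move=> sh t0 a.
have sa : star a = h - ('i * t%:C) *: I.
  by rewrite starD sh starZ star1 rmorphM /= conj_i conj_real mulNr scaleNr.
have aa : star a * a = a * star a.
  rewrite sa; apply/commr_sym/commrB; last exact: comm_scalar.
  by apply/commr_sym/commrD => //; exact: comm_scalar.
have eqn : rnorm (a y) = rnorm (star a y).
  apply/eqP; rewrite -(eqrXn2 (ltn0Sn 1)) ?rnorm_ge0 // !rnorm_sqr.
  have -> : hip (a y) (a y) = hip y ((star a * a) y) by rewrite adj_funP.
  by rewrite aa [X in _ == rnorm X]adj_funP.
have e : a y - star a y = ('i * 2%:R) *: (t%:C *: y).
  rewrite sa /= opprD opprK addrACA subrr add0r -mulr2n -scaler_nat !scalerA.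
  by congr (_ *: _); rewrite mulrCA mulrA mulrC.
suff : t * rnorm y <= rnorm (a y) by split; rewrite -?eqn.
have i1 : `|'i : R[i]| = 1 by rewrite normc_def /= expr0n add0r expr1n sqrtr1.
have := rnormD (a y) (- star a y); rewrite e rnormN -eqn -scalerA rnormZ_unit //.
rewrite -(rmorph_nat (real_complex R)) !rnormZr //; lra.
Qed.

(** For large [t] this is a Neumann inverse. Invertibility descends from 2s to s: the inverse at 2s
    is bounded by 1/(2s), so a shift by [s] perturbs by at most 1/2. Finitely many halvings reach
    [t]. *)
Lemma selfadjoint_resolvent h t : star h = h -> 0 < t ->
  exists w, inverse_of (h + ('i * t%:C) *: I) w.
Proof.
move=> sh.
have i0 : 'i != 0 :> R[i] by rewrite eq_complex /= oner_eq0 andbF.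
have iV : 'i^-1 = - 'i :> R[i].
  by apply: (mulfI i0); rewrite mulfV // mulrN -expr2 sqr_i opprK.
have [M [M0 hM]] := ex_bounded_by h.
have large s : 2 * M <= s -> exists w, inverse_of (h + ('i * s%:C) *: I) w.
  move=> Ms; have s0 : 0 < s by lra.
  have c0 : 'i * s%:C != 0 :> R[i].
    by rewrite mulf_neq0 // -[0]/(0%:C) (inj_eq (@complexI R)) gt_eqF.
  have [|w hw] := @neumann R A H (s^-1%:C *: ('i *: h)).
    apply: bounded_by_le (bounded_byZ _ (bounded_by_i hM)) _.
      by rewrite invr_ge0 ltW.
    by rewrite mulrC ler_pdivrMr //; lra.
  exists (('i * s%:C)^-1 *: w).
  have -> : h + ('i * s%:C) *: I = ('i * s%:C) *: (1 - s^-1%:C *: ('i *: h)).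
    rewrite scalerBr addrC !scalerA.
    have -> : 'i * s%:C * s^-1%:C * 'i = -1 :> R[i].
      rewrite -(mulrA 'i) -rmorphM /= mulfV ?gt_eqF // mulr1.
      by rewrite -expr2 sqr_i.
    by rewrite scaleN1r opprK.
  exact: inverse_ofZ.
have half s : 0 < s -> (exists w, inverse_of (h + ('i * (2 * s)%:C) *: I) w) ->
    exists w, inverse_of (h + ('i * s%:C) *: I) w.
  move=> s0 [w hw].
  have s2 : 0 < 2 * s by lra.
  set b := h + _ in hw.
  have bw : bounded_by w (2 * s)^-1.
    split=> [|x]; first by rewrite invr_ge0 ltW.
    rewrite ![_^-1 * _]mulrC !ler_pdivlMr // ![_ * (2 * s)]mulrC.
    have [h1 _] := selfadjoint_resolvent_bound (w x) sh (ltW s2).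
    have [_ h2] := selfadjoint_resolvent_bound (star w x) sh (ltW s2).
    split.
      by apply: le_trans h1 _; rewrite -[_ (w x)]/((b * w) x) hw.1.
    apply: le_trans h2 _; rewrite -[star b (star w x)]/((star b * star w) x).
    by rewrite (inverse_of_star hw).1.
  have [|v hv] := @neumann R A H (s%:C *: ('i *: w)).
    apply: bounded_by_le (bounded_byZ (ltW s0) (bounded_by_i bw)) _.
    by rewrite ler_pdivrMr //; lra.
  exists (v * w); rewrite (_ : _ + _ = b * (1 - s%:C *: ('i *: w))).
    exact: inverse_ofM.
  rewrite mulrBr mulr1 !adjointableMZr hw.1 scalerA -addrA -scalerBl.
  by congr (_ + _ *: _); rewrite [(2 * s)%:C]rmorphM /= rmorph_nat; ring.
move=> t0.
have [|||n hn] := @expr_small R 2^-1 (t / (2 * M)) _ _ _;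
  [lra|lra| by rewrite divr_gt0 //; lra|].
have : exists w, inverse_of (h + ('i * (2 ^+ n * t)%:C) *: I) w.
  apply: large; rewrite ltr_pdivlMr in hn; last lra.
  have p0 : 0 < 2 ^+ n :> R by exact: exprn_gt0.
  rewrite exprVn -(ltr_pM2l p0) mulrA mulfV ?gt_eqF // mul1r in hn.
  exact: ltW.
elim: n {hn} => [|n IH]; first by rewrite mul1r.
rewrite exprS -mulrA => hh; apply/IH/half => //.
by rewrite mulr_gt0 // exprn_gt0.
Qed.

(** The operator factors as (h + iu)(h - iu) with u^2 = t. *)
Lemma selfadjoint_sqr_addr_inv h t : star h = h -> 0 < t ->
  exists w, inverse_of (h * h + t%:C *: I) w.
Proof.
move=> sh t0; have u0 : 0 < Num.sqrt t by rewrite sqrtr_gt0.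
have [w hw] := selfadjoint_resolvent sh u0.
exists (star w * w); set c := _ *: _ in hw.
have -> : h * h + t%:C *: I = (h + c) * star (h + c).
  rewrite starD sh starZ rmorphM /= conj_i conj_real star1 mulNr scaleNr -/c.
  rewrite mulrBr !mulrDl (comm_scalar _ h) -/c opprD addrA addrK; congr (_ + _).
  rewrite adjointableMZl adjointableMZr scalerA mulr1 -scaleNr; congr (_ *: _).
  rewrite mulrACA -expr2 sqr_i -rmorphM /= -expr2 sqr_sqrtr ?ltW //.
  by rewrite mulN1r opprK.
exact: inverse_ofM (inverse_of_star hw).
Qed.

End Resolvents.

(** * Fourth roots by descent along the half-line *)

Section FourthRoots.
Variables (R : realType) (A : cstarAlgType R) (H : hilbertModType A).
Local Notation I := (1 : 'L(H)).
Implicit Types (S T U a b c g h v w z : 'L(H)) (M s t : R).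

Lemma starXn T n : star (T ^+ n) = star T ^+ n.
Proof. by elim: n => [|n IH]; rewrite ?star1 // exprS exprSr starMr IH. Qed.

(** Were [E] false at 0, the supremum of its failures would have failures just below or at it and
    validity just above it, against the local transfer. *)
Lemma continuous_descent (E : R -> Prop) (T0 : R) :
  (forall t, T0 <= t -> E t) ->
  (forall m, 0 <= m -> exists2 d, 0 < d & forall s t,
     `|s - m| <= d -> `|t - m| <= d -> E s -> E t) -> E 0.
Proof.
move=> hT hloc; apply: contrapT => E0.
pose S := [set t | 0 <= t /\ ~ E t].
have ubS : ubound S T0.
  by move=> t [t0 Et]; rewrite leNgt; apply/negP => /ltW /hT.
have S0 : S 0 by [].
have hS : has_sup S by split; [exists 0|exists T0].
have m0 : 0 <= sup S by apply: sup_ubound => //; exists T0.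
have [d d0 hd] := hloc _ m0.
have [t [t0 Et] ht] := sup_adherent d0 hS.
have tm : t <= sup S by apply: sup_ubound; [exists T0|split].
apply/Et/(hd (sup S + d)).
- by rewrite addrC addKr ger0_norm // ltW.
- by rewrite ler_norml; apply/andP; split; lra.
apply: contrapT => Ed.
suff : sup S + d <= sup S by lra.
by apply: sup_ubound; [exists T0|split => //; lra].
Qed.

(** Descent on t for a + t. For large t, a + t is t(1 - x) with [x] of norm at most 1/2. Near m,
    with [w] the inverse of a + m, it is (a + m)(1 + (t - m)w), whose second factor has a root near
    1. *)
Lemma root4_of_positive a : star a = a ->
  (forall t, 0 <= t -> exists w, inverse_of (a + t%:C *: I) w) ->
  exists g, [/\ star g = g, bicommutant a g & g ^+ 4 = a].
Proof.
move=> sa ha.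
pose E t := exists g, [/\ star g = g, bicommutant a g & g ^+ 4 = a + t%:C *: I].
suff [g [sg cg eg]] : E 0 by exists g; split=> //; rewrite eg rmorph0 scale0r addr0.
have [M [M0 hM]] := ex_bounded_by a.
apply: (@continuous_descent _ (2 * M)) => [t Mt|m m0].
  have t0 : 0 < t by lra.
  pose x := - (t^-1%:C *: a).
  have [||e [se ce ee]] := @root4_one_minus R A H x.
  - apply/bounded_byN; apply: bounded_by_le (bounded_byZ _ hM) _.
      by rewrite invr_ge0 ltW.
    by rewrite mulrC ler_pdivrMr //; lra.
  - by rewrite starN starZr sa.
  pose r := Num.sqrt (Num.sqrt t).
  have r4 : r ^+ 4 = t.
    by rewrite -[4%N]/(2 * 2)%N exprM !sqr_sqrtr ?sqrtr_ge0 // ltW.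
  exists (r%:C *: e); split; first by rewrite starZr se.
    by move=> z za; apply/commrZ/ce; rewrite /x; apply/commrN/commrZ.
  have exprZL (l : R[i]) T n : (l *: T) ^+ n = l ^+ n *: T ^+ n.
    elim: n => [|n IH]; first by rewrite !expr0 scale1r.
    by rewrite !exprS IH adjointableMZl adjointableMZr scalerA.
  rewrite exprZL -rmorphXn /= r4 ee opprK scalerDr scalerA -rmorphM /=.
  by rewrite mulfV ?gt_eqF // rmorph1 scale1r addrC.
have [w hw] := ha m m0.
have [C [C0 hC]] := ex_bounded_by w.
have sw : star w = w.
  apply: (inverse_of_uniq (inverse_of_star hw)).
  by rewrite starD sa starZr star1.
have wa : bicommutant a w.
  move=> z za; apply: (inverse_of_bicommutant hw); apply: commrD => //.
  exact: comm_scalar.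
(* On this radius (u - m)w has norm at most 1/2. *)
exists (2 * C)^-1 => [|s t hs ht [g [sg cg eg]]]; first by rewrite invr_gt0; lra.
have pert u : `|u - m| <= (2 * C)^-1 -> exists e, [/\ star e = e, bicommutant a e,
    e ^+ 4 = 1 + (u - m)%:C *: w & exists v, inverse_of e v].
  move=> hu; pose x := - ((u - m)%:C *: w).
  have bx : bounded_by x 2^-1.
    apply/bounded_byN; apply: bounded_by_le (bounded_by_scale _ hC) _.
    have : `|u - m| * C <= (2 * C)^-1 * C by rewrite ler_wpM2r // ltW.
    have -> : (2 * C)^-1 * C = 2^-1 by field; rewrite gt_eqF.
    by [].
  have [|e [se ce ee]] := root4_one_minus bx; first by rewrite starN starZr sw.
  exists e; split=> //.
  - by move=> z za; apply/ce/commrN/commrZ/wa.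
  - by rewrite ee opprK.
  - have [v] := neumann bx; rewrite -ee => /inverse_of_root.
    by exists (e ^+ 3 * v).
have shift u : a + u%:C *: I = (a + m%:C *: I) * (1 + (u - m)%:C *: w).
  rewrite mulrDr mulr1 adjointableMZr hw.1 -addrA -scalerDl -rmorphD /=.
  by rewrite (addrC m) subrK.
have [e [se ce ee [v hv]]] := pert s hs.
have [f [sf cf ef _]] := pert t ht.
have cv : bicommutant a v.
  by move=> z za; apply: (inverse_of_bicommutant hv); apply: ce.
have sv : star v = v.
  by apply: (inverse_of_uniq (inverse_of_star hv)); rewrite se.
have mutual T U : bicommutant a T -> bicommutant a U -> GRing.comm T U.
  by move=> hT hU; apply: hU; apply/commr_sym/hT.
have ev : e ^+ 4 * v ^+ 4 = 1.
  by rewrite -exprMn_comm ?hv.1 ?expr1n //; exact: mutual.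
have cgv : bicommutant a (g * v).
  by move=> z za; apply: commrM; [apply: cg|apply: cv].
(* With [v] the inverse of [e], the factor belonging to [s] is exchanged for the one belonging to
   [t]. *)
exists (g * v * f).
split.
- by rewrite !starMr sg sv sf (mutual v g) // (mutual f (g * v)).
- by move=> z za; apply: commrM; [apply: cgv|apply: cf].
rewrite (exprMn_comm _ (mutual _ _ cgv cf)) (exprMn_comm _ (mutual _ _ cg cv)).
by rewrite eg ef shift -ee -(mulrA (a + _)) ev mulr1 -shift.
Qed.

End FourthRoots.

(** * The range projection of an idempotent *)

Section IdempotentModulus.
Variables (R : realType) (A : cstarAlgType R) (H : hilbertModType A).
Local Notation I := (1 : 'L(H)).
Implicit Types (P Q S T U a b c g h p v w z : 'L(H)) (M s t : R).

Lemma star_mul_eq0 T : star T * T = 0 -> T = 0.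
Proof.
move=> h; apply: adjointableP => x; apply: hip_eq0.
by rewrite adj_funP -[adj_adj T (T x)]/((star T * T) x) h hip0r.
Qed.

(** Taking adjoints of the invariance identity gives p c = p c p as well. *)
Lemma comm_of_invariant c p :
  star c = c -> star p = p -> c * p = p * c * p -> GRing.comm c p.
Proof.
move=> sc sp e; have := congr1 star e.
by rewrite !starMr sp sc mulrA -e => h; rewrite /GRing.comm h.
Qed.

(** The operator is block diagonal: a + t on the range of [p], and the scalar 1 + t on its
    complement. *)
Lemma inverse_of_corner a p v t : 0 <= t -> GRing.comm a p -> p * p = p ->
  inverse_of (a + t%:C *: I) v ->
  exists w, inverse_of (a * p + (1 - p) + t%:C *: I) w.
Proof.
move=> t0 ap pp; set b := a + _ => hv.
have s0 : (1 + t)%:C != 0 :> R[i].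
  by rewrite -[0]/(0%:C) (inj_eq (@complexI R)) gt_eqF //; lra.
have bp : GRing.comm p b by apply: commrD; [exact: commr_sym|exact: comm_scalar].
have vp : GRing.comm p v by exact: inverse_of_bicommutant hv _ bp.
have pq : p * (1 - p) = 0 by rewrite mulrBr mulr1 pp subrr.
have qp : (1 - p) * p = 0 by rewrite mulrBl mul1r pp subrr.
have qq : (1 - p) * (1 - p) = 1 - p by rewrite mulrBl mul1r pq subr0.
have -> : a * p + (1 - p) + t%:C *: I = b * p + (1 + t)%:C *: (1 - p).
  rewrite mulrDl adjointableMZl mul1r rmorphD scalerDl rmorph1 scale1r scalerBr.
  set q := 1 - p; set X := t%:C *: I; set Y := t%:C *: p.
  by rewrite -!addrA !(addrCA Y) subrr addr0.
exists (v * p + (1 + t)%:C^-1 *: (1 - p)).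
(* One computation serves both orders of the product. *)
have E c d : c * d = 1 -> GRing.comm p c -> GRing.comm p d ->
    forall l m : R[i], l * m = 1 ->
    (c * p + l *: (1 - p)) * (d * p + m *: (1 - p)) = 1.
  move=> cd pc pd l m lm.
  rewrite mulrDl !mulrDr !adjointableMZl !adjointableMZr -pd !mulrA.
  rewrite qp mul0r scaler0 add0r.
  rewrite -(mulrA c p (1 - p)) pq mulr0 scaler0 addr0 -(mulrA c p p) pp qq.
  by rewrite scalerA lm scale1r -(mulrA c) pd mulrA cd mul1r addrC subrK.
split; apply: E => //; rewrite ?hv.1 ?hv.2 ?mulfV ?mulVf //.
Qed.

(** With k = 1 + h^2, one has kQ = Q [star Q] Q, hence kS = S^2 = Sk and S = kp. So S + (1 - p) is
    [k] on the range of [p] and 1 elsewhere, and k + t = h^2 + (1 + t) is invertible. *)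
Lemma idempotent_range_root Q : is_idempotent Q -> let S := Q * star Q in
  exists p g, [/\ star p = p, p * p = p, S * p = S &
    forall c, star c = c -> GRing.comm c S -> GRing.comm c p] /\
    [/\ star g = g, bicommutant (S + (1 - p)) g, g ^+ 4 = S + (1 - p) &
      exists v, inverse_of g v].
Proof.
move=> qq S; rewrite /is_idempotent in qq.
pose Q' := star Q.
have qq' : Q' * Q' = Q' by rewrite -starMr qq.
pose h := 'i *: (Q - Q').
have sh : star h = h.
  by rewrite starZ conj_i starB starK scaleNr -scalerN opprB.
pose k := h * h + I.
have ek : k = 1 - Q - Q' + Q * Q' + Q' * Q.
  rewrite /k adjointableMZl adjointableMZr scalerA -expr2 sqr_i scaleN1r.
  rewrite mulrBr !mulrBl qq qq' !opprB.
  by rewrite [LHS](AC (2*2*1) (5*4*2*1*3)).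
have kQ : k * Q = Q * Q' * Q.
  rewrite ek !mulrDl !mulNr mul1r qq subrr sub0r -(mulrA Q') qq addrC addrA.
  by rewrite subrr add0r.
have sk : star k = k by rewrite starD starMr sh star1.
have sS : star S = S by rewrite starMr starK.
have kS : k * S = S * S by rewrite mulrA kQ !mulrA.
have Sk : S * k = S * S by rewrite -{1}sS -{1}sk -starMr kS starMr sS.
have [w hw] := selfadjoint_sqr_addr_inv sh ltr01.
rewrite rmorph1 scale1r -/k in hw.
have sw : star w = w.
  by apply: (inverse_of_uniq (inverse_of_star hw)); rewrite sk.
have Sw : GRing.comm S w.
  by apply: (inverse_of_bicommutant hw); rewrite /GRing.comm Sk.
pose p := S * w.
have kp : k * p = S by rewrite mulrA kS -Sk -mulrA hw.1 mulr1.
have sp : star p = p by rewrite starMr sS sw.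
have Sp : S * p = S by rewrite mulrA -Sk -mulrA hw.1 mulr1.
have wp : w * p = p * w by rewrite /p mulrA -Sw.
have pp : p * p = p by rewrite {1}/p -mulrA wp mulrA Sp.
have kpc : GRing.comm k p.
  by rewrite /GRing.comm kp -sp -{1}sk -starMr kp.
have inv t : 0 <= t -> exists v, inverse_of (S + (1 - p) + t%:C *: I) v.
  move=> t0; rewrite -kp; have t1 : 0 < 1 + t by lra.
  have [v hv] := selfadjoint_sqr_addr_inv sh t1.
  apply: (@inverse_of_corner _ _ v) => //.
  by rewrite rmorphD rmorph1 scalerDl scale1r addrA in hv.
have [|//|g [sg cg eg]] := @root4_of_positive R A H (S + (1 - p)).
  by rewrite starD starB sS star1 sp.
exists p, g; split; split=> //; last first.
  have [v] := inv 0 (lexx 0); rewrite rmorph0 scale0r addr0 -eg => /inverse_of_root.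
  by exists (g ^+ 3 * v).
move=> c sc cS.
have pS : p * S = S by rewrite -sS -{1}sp -starMr Sp.
have e : c * p = p * c * p.
  have h1 : c * p = S * (c * w) by rewrite /p mulrA cS -mulrA.
  by rewrite -mulrA h1 [RHS]mulrA pS.
exact: comm_of_invariant.
Qed.

End IdempotentModulus.

(** * Positivity in the algebra of adjointable operators *)

Section PositiveOperators.
Variables (R : realType) (A : cstarAlgType R) (H : hilbertModType A).
Local Notation I := (1 : 'L(H)).
Implicit Types (J P Q T a b c g p v w : 'L(H)) (l : R[i]) (t : R).

(** As 1 is present, (a, l) -> a + l 1 is multiplicative on the unitization; the first component is
    the product less its scalar part. *)
Lemma unitization_mulP a v l m :
  unitization_mul (- a, l) (v, m) =
    (- ((a - l *: I) * (v + m *: I)) - (l * m) *: I, l * m) /\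
  unitization_mul (v, m) (- a, l) =
    (- ((v + m *: I) * (a - l *: I)) - (m * l) *: I, m * l).
Proof.
rewrite /unitization_mul /= !adjointable_smulE; split; congr pair.
  rewrite mulrDr mulrBl adjointableMZl mul1r adjointableMZr mulr1 scalerBr scalerA.
  by rewrite [m * l]mulrC !opprD !opprK mulNr scalerN !addrA addrK.
rewrite mulrDl mulrBr adjointableMZl mul1r adjointableMZr mulr1 scalerBr scalerA.
rewrite !opprD !opprK mulrN scalerN !addrA addrK -!addrA.
by congr (_ + _); rewrite addrC.
Qed.

(** The scalar part of an inverse must be l^-1, so its first component is -w - l^-1 1, where -w
    inverts l 1 - a. *)
Lemma unitization_invertibleP a l : l != 0 ->
  unitization_invertible (- a, l) <-> exists w, inverse_of (a - l *: I) w.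
Proof.
move=> l0; split=> [[[v m]]|[w [aw wa]]].
  have [-> ->] := unitization_mulP a v l m => -[p1 p2].
  have [e1 e2] : - ((a - l *: I) * (v + m *: I)) - (l * m) *: I = 0 /\ l * m = 1.
    by split; [exact: (congr1 fst p1)|exact: (congr1 snd p1)].
  have [e3 e4] : - ((v + m *: I) * (a - l *: I)) - (m * l) *: I = 0 /\ m * l = 1.
    by split; [exact: (congr1 fst p2)|exact: (congr1 snd p2)].
  exists (- (v + m *: I)); rewrite /inverse_of mulrN mulNr.
  split; [move: e1; rewrite e2|move: e3; rewrite e4];
    by rewrite scale1r => /eqP; rewrite subr_eq0 => /eqP.
exists (- w - l^-1 *: I, l^-1).
have [-> ->] := unitization_mulP a (- w - l^-1 *: I) l l^-1.
by rewrite subrK mulrN mulNr aw wa !opprK mulfV // mulVf // scale1r subrr.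
Qed.

Lemma positiveP a : positive a <-> star a = a /\
  forall l, ~ 0 <= l -> exists w, inverse_of (a - l *: I) w.
Proof.
have n0 l : ~ 0 <= l -> l != 0.
  by move=> h; apply/eqP => l0; apply: h; rewrite l0.
split=> -[sa h]; split=> // l.
  move=> l0; apply/unitization_invertibleP; first exact: n0.
  by apply: contrapT => /h.
move=> hl; apply: contrapT => l0.
by apply/hl/unitization_invertibleP/h; first exact: n0.
Qed.

Lemma positive_addr_inv a t : positive a -> 0 < t ->
  exists w, inverse_of (a + t%:C *: I) w.
Proof.
move=> /positiveP[_ h] t0; have [|w] := h (- t)%:C.
  by rewrite ler0c => ?; lra.
by rewrite rmorphN scaleNr opprK; exists w.
Qed.

(** A nonreal point x + iy is excluded by the resolvent of the selfadjoint g^2 - x, through an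
    adjoint when y > 0; a negative real one by the invertibility of g^2 + t for t > 0. *)
Lemma positive_sqr g : star g = g -> positive (g * g).
Proof.
move=> sg; apply/positiveP; split; first by rewrite starMr sg.
case=> x y hl; pose h := g * g - x%:C *: I.
have sh : star h = h by rewrite starB starMr sg starZr star1.
have e : g * g - (x +i* y) *: I = h + ('i * (- y)%:C) *: I.
  rewrite /h -addrA -!scaleNr -scalerDl; congr (_ + _ *: _).
  by rewrite [x +i* y]complexE /= opprD rmorphN mulrN.
rewrite e.
have [y0|y0|y0] := ltgtP y 0.
- by apply: selfadjoint_resolvent => //; lra.
- have [w hw] := selfadjoint_resolvent sh y0.
  exists (star w); suff -> : h + ('i * (- y)%:C) *: I = star (h + ('i * y%:C) *: I).
    exact: inverse_of_star.
  rewrite starD sh starZ rmorphM /= conj_i conj_real star1.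
  by rewrite rmorphN mulrN mulNr.
- rewrite y0 oppr0 rmorph0 mulr0 scale0r addr0.
  have [|w hw] := @selfadjoint_sqr_addr_inv R A H g (- x) sg.
    by move: hl; rewrite y0 ler0c => /negP; rewrite -ltNge; lra.
  by exists w; rewrite rmorphN scaleNr in hw.
Qed.

Lemma positive_conj J a : J * J = 1 -> star J = J ->
  positive a -> positive (J * a * J).
Proof.
move=> JJ sJ /positiveP[sa h]; apply/positiveP; split.
  by rewrite !starMr sJ sa mulrA.
move=> l /h [w hw]; exists (J * (w * J)).
have -> : J * a * J - l *: I = J * (a - l *: I) * J.
  by rewrite mulrBr mulrBl adjointableMZr adjointableMZl mulr1 JJ.
by apply: inverse_ofM => //; apply: inverse_ofM.
Qed.

End PositiveOperators.

(** * The modulus of an idempotent *)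

Section ModulusOfIdempotent.
Variables (R : realType) (A : cstarAlgType R) (H : hilbertModType A).
Local Notation I := (1 : 'L(H)).
Implicit Types (J P Q T a b c g p v w : 'L(H)).

(** The root is (pg)^2, the square of a selfadjoint operator, and its square is p g^4 = S. *)
Lemma idempotent_psqrt Q : is_idempotent Q ->
  exists b, [/\ positive b, b * b = Q * star Q &
    forall c, positive c -> c * c = Q * star Q -> c = b].
Proof.
move=> /idempotent_range_root[p [g [[sp pp Sp Sc] [sg cg eg [f gf]]]]].
set S := Q * star Q in Sp Sc cg eg *.
have sS : star S = S by rewrite starMr starK.
have pS : p * S = S by rewrite -sS -{1}sp -starMr Sp.
have pk : GRing.comm p (S + (1 - p)).
  by apply: commrD; [rewrite /GRing.comm Sp pS|apply: commrB; [exact: commr1|]].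
have pg := cg _ pk.
have gg : p * g * (p * g) = p * g ^+ 2.
  by rewrite expr2 !mulrA -(mulrA p g p) -pg mulrA pp.
exists (p * g * (p * g)); split.
- by apply: positive_sqr; rewrite starMr sp sg -pg.
- rewrite gg mulrA -(mulrA p _ p) -(commrX 2 pg) mulrA pp -mulrA -exprD eg.
  by rewrite mulrDr pS mulrBr mulr1 pp subrr addr0.
move=> c cpos cS; have [sc _] := cpos.
have cSc : GRing.comm c S by rewrite /GRing.comm -cS mulrA.
have cp : GRing.comm c p := Sc _ sc cSc.
have cpc : c * p = c.
  have /eqP : c * (1 - p) = 0.
    apply: star_mul_eq0.
    rewrite starMr sc starB star1 sp -mulrA (mulrA c) cS mulrBr mulr1 Sp.
    by rewrite subrr mulr0.
  by rewrite mulrBr mulr1 subr_eq0 => /eqP.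
(* Filling in the complement of [p] makes d^2 = g^4 invertible, and it suffices to show d = g^2. *)
pose d := c + (1 - p).
have dd : d * d = S + (1 - p).
  have cq : c * (1 - p) = 0 by rewrite mulrBr mulr1 cpc subrr.
  have qc : (1 - p) * c = 0 by rewrite mulrBl mul1r -cp cpc subrr.
  have qq : (1 - p) * (1 - p) = 1 - p.
    by rewrite mulrBl mul1r mulrBr mulr1 pp subrr subr0.
  by rewrite mulrDl [X in X + _]mulrDr [X in _ + X]mulrDr cq qc qq addr0 add0r cS.
(* For t > 0, d + t is invertible by positivity of [c]; at t = 0, because d^2 = g^4 is. *)
have [r [sr cr er]] : exists r, [/\ star r = r, bicommutant d r & r ^+ 4 = d].
  apply: root4_of_positive => [|t]; first by rewrite starD starB sc star1 sp.
  rewrite le_eqVlt => /orP[/eqP <-|t0].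
    rewrite rmorph0 scale0r addr0.
    have hf : inverse_of (d ^+ 2) (f * f * (f * f)).
      rewrite expr2 dd -eg (_ : g ^+ 4 = g * g * (g * g)).
        by apply: inverse_ofM; apply: inverse_ofM.
      by rewrite -!expr2 -exprM.
    by exists (d ^+ 1 * (f * f * (f * f))); apply: inverse_of_root.
  have [v hv] := positive_addr_inv cpos t0.
  rewrite /d -[c in c + (1 - p)]cpc.
  exact: (inverse_of_corner (ltW t0) cp pp hv).
have gc : GRing.comm c g.
  by apply: cg; apply: commrD => //; apply: commrB; [exact: commr1|].
have gd : GRing.comm g d.
  apply: commrD; first exact: commr_sym.
  by apply: commrB; [exact: commr1|exact: commr_sym].
have gr : GRing.comm g r := cr _ gd.
have fr : GRing.comm f r.
  by apply/commr_sym/(inverse_of_bicommutant gf)/commr_sym.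
have sf : star f = f by apply: (inverse_of_uniq (inverse_of_star gf)); rewrite sg.
(* Here [f] inverts [g] and d = r^4, so g^2 + d = g^2 (1 + h^2) is invertible. *)
pose h := f * r ^+ 2.
have fr2 : GRing.comm f (r ^+ 2) by exact: commrX.
have gr2 : GRing.comm g (r ^+ 2) by exact: commrX.
have sh : star h = h by rewrite starMr starXn sr sf -fr2.
have [w hw] := selfadjoint_sqr_addr_inv sh ltr01.
have egd : g ^+ 2 + d = g ^+ 2 * (h * h + 1%:C *: I).
  rewrite mulrDr rmorph1 scale1r mulr1 addrC; congr (_ + _).
  have gh : g * h = r ^+ 2 by rewrite mulrA gf.1 mul1r.
  by rewrite [g ^+ 2]expr2 -mulrA (mulrA g h) gh mulrA gr2 -mulrA gh -exprD er.
have gdd : g ^+ 2 = d.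
  apply/eqP; rewrite -subr_eq0; apply/eqP.
  (* Commuting operators with equal squares: their difference times their invertible sum
     vanishes. *)
  have gd2 : GRing.comm d (g ^+ 2) by apply/commrX/commr_sym.
  have e0 : (g ^+ 2 - d) * (g ^+ 2 + d) = 0.
    by rewrite mulrDr !mulrBl gd2 dd -eg -exprD addrA subrK subrr.
  have hinv : inverse_of (g ^+ 2 + d) (w * (f * f)).
    by rewrite egd expr2; apply: inverse_ofM => //; apply: inverse_ofM.
  by rewrite -[LHS]mulr1 -hinv.1 (mulrA (_ - _)) e0 mul0r.
by rewrite gg gdd mulrDr mulrBr mulr1 pp subrr addr0 -cp cpc.
Qed.

(** Existence of a root excludes the default value of [xget], and uniqueness identifies the chosen
    one. *)
Lemma modulus_idempotentP Q : is_idempotent Q ->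
  [/\ positive (modulus Q), modulus Q * modulus Q = star Q * Q &
    forall c, positive c -> c * c = star Q * Q -> c = modulus Q].
Proof.
move=> qq; have [|b [bpos bb ub]] := @idempotent_psqrt (star Q).
  by rewrite /is_idempotent -starMr qq.
rewrite starK in bb ub.
suff -> : modulus Q = b by [].
rewrite /modulus /psqrt.
case: xgetP => [y -> [ypos yy]|/(_ b) []]; [exact: ub|by []].
Qed.

(** (1 - Q)T times its adjoint is (1 - Q) Q [star Q] [star (1 - Q)], which vanishes. *)
Lemma idempotent_absorb Q T : is_idempotent Q ->
  T * star T = Q * star Q -> Q * T = T.
Proof.
move=> qq e; suff /(congr1 star) : star ((1 - Q) * T) = 0.
  rewrite starK star0 mulrBl mul1r => /eqP.
  by rewrite subr_eq0 eq_sym => /eqP.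
apply: star_mul_eq0; rewrite starK starMr mulrA -(mulrA _ T) e mulrA mulrBl mul1r qq.
by rewrite subrr !mul0r.
Qed.

(** Absorption gives TQ = Q and, for the adjoints, TQ = T. *)
Lemma idempotent_inj Q T : is_idempotent Q -> is_idempotent T ->
  T * star T = Q * star Q -> star T * T = star Q * Q -> T = Q.
Proof.
move=> qq tt e1 e2.
have sidem a : is_idempotent a -> is_idempotent (star a).
  by rewrite /is_idempotent -starMr => ->.
rewrite -(idempotent_absorb tt (esym e1)).
apply: (can_inj (@starK R 'L(H))); rewrite starMr.
by rewrite (idempotent_absorb (sidem _ qq)) // !starK.
Qed.

(** * The symmetry 2P - 1 and the equivalences *)

Lemma projection_symmetry P : is_projection P ->
  (2 *: P - 1) * (2 *: P - 1) = 1 /\ star (2 *: P - 1) = 2 *: P - 1.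
Proof.
move=> [pp sp]; split; last first.
  by rewrite starB star1 starZ sp rmorph_nat.
rewrite scaler_nat mulr2n; set D := P + P.
have DD : D * D = D + D by rewrite mulrDl mulrDr pp.
by rewrite mulrBr mulr1 mulrBl mul1r DD addrK opprB addrC subrK.
Qed.

Lemma corner_ext P a b : P * a * P = P * b * P ->
  P * a * (1 - P) = P * b * (1 - P) -> (1 - P) * a * P = (1 - P) * b * P ->
  (1 - P) * a * (1 - P) = (1 - P) * b * (1 - P) -> a = b.
Proof.
move=> h1 h2 h3 h4.
have dec c : c = (P * c * P + P * c * (1 - P)) +
    ((1 - P) * c * P + (1 - P) * c * (1 - P)).
  have e : P + (1 - P) = 1 by rewrite addrC subrK.
  by rewrite -(mulrDr (P * c)) -(mulrDr ((1 - P) * c)) e !mulr1 -mulrDl e mul1r.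
by rewrite (dec a) h1 h2 h3 h4 -dec.
Qed.

(** [J] is 1 on the range of [P] and -1 on its complement, so conjugation by it keeps the diagonal
    corners and negates the other two. *)
Lemma quasi_projection_pairP P Q : is_projection P -> is_idempotent Q ->
  quasi_projection_pair P Q <-> star Q = (2 *: P - 1) * Q * (2 *: P - 1).
Proof.
move=> hP qq; have [pp sp] := hP; set J := 2 *: P - 1.
have PJ : P * J = P.
  by rewrite mulrBr mulr1 adjointableMZr pp scaler_nat mulr2n addrK.
have JP : J * P = P.
  by rewrite mulrBl mul1r adjointableMZl pp scaler_nat mulr2n addrK.
have JsubP : J - P = - (1 - P).
  by rewrite opprB addrAC scaler_nat mulr2n addrK.
have qJ : (1 - P) * J = - (1 - P) by rewrite mulrBl mul1r PJ.
have Jq : J * (1 - P) = - (1 - P) by rewrite mulrBr mulr1 JP.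
have sq : star (1 - P) = 1 - P by rewrite starB star1 sp.
split=> [[_ h1 h2 h3]|e].
  apply: (@corner_ext P).
  - by rewrite h1 !mulrA PJ -(mulrA _ J) JP.
  - by rewrite h2 !mulrA PJ -(mulrA _ J) Jq mulrN.
  (* The remaining corner comes from the adjoint of the second condition. *)
  - have := congr1 star h2; rewrite starN !starMr starK sq sp !mulrA => e.
    by rewrite qJ -(mulrA _ J) JP mulNr mulNr e opprK.
  - by rewrite h3 !mulrA qJ -(mulrA _ J) Jq mulrN !mulNr opprK.
rewrite /quasi_projection_pair e; split=> //.
- by rewrite !mulrA PJ -(mulrA _ J) JP.
- by rewrite !mulrA PJ -(mulrA _ J) Jq mulrN.
- by rewrite !mulrA qJ -(mulrA _ J) Jq mulrN !mulNr opprK.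
Qed.

Lemma modulus_symmetry J Q : J * J = 1 -> star J = J -> is_idempotent Q ->
  star Q = J * Q * J <-> modulus (star Q) = J * modulus Q * J.
Proof.
move=> JJ sJ qq.
have [mpos mm um] := modulus_idempotentP qq.
have sqq : is_idempotent (star Q) by rewrite /is_idempotent -starMr qq.
have [npos nn un] := modulus_idempotentP sqq; rewrite starK in nn un.
have conjM a b : J * a * J * (J * b * J) = J * (a * b) * J.
  by rewrite !mulrA -(mulrA _ J J) JJ mulr1.
split=> [sQ|e].
  apply/esym/un; first exact: positive_conj.
  rewrite conjM mm -conjM -sQ.
  by congr (_ * _); rewrite sQ !mulrA JJ mul1r -mulrA JJ mulr1.
(* Squaring the hypothesis gives Q [star Q] = J ([star Q] Q) J, so [T] and [Q] satisfy the
   assumptions of [idempotent_inj]. *)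
pose T := J * star Q * J.
have sT : star T = J * Q * J by rewrite !starMr starK sJ mulrA.
have eQ : Q * star Q = J * (star Q * Q) * J by rewrite -nn e conjM mm.
have tq : T = Q.
  apply: idempotent_inj => //.
  - by rewrite /is_idempotent conjM sqq.
  - by rewrite sT conjM eQ.
  - by rewrite sT conjM eQ !mulrA JJ mul1r -mulrA JJ mulr1.
by rewrite -{1}tq sT.
Qed.

End ModulusOfIdempotent.

Theorem theorem2p5 (R : realType) (A : cstarAlgType R) (H : hilbertModType A)
    (P Q : 'L(H)) (hP : is_projection P) (hQ : is_idempotent Q) :
  [<-> quasi_projection_pair P Q;
       star Q = (2 *: P - 1) * Q * (2 *: P - 1);
       modulus (star Q) = (2 *: P - 1) * modulus Q * (2 *: P - 1)].
Proof.
have [JJ sJ] := projection_symmetry hP.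
have hsym := modulus_symmetry JJ sJ hQ.
tfae.
- by move/(quasi_projection_pairP hP hQ).
- by move/hsym.
- by move/hsym/(quasi_projection_pairP hP hQ).
Qed.
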